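(* Let $K$ be a field and let $A=K[a_1,\ldots,a_n]$ be a finitely generated $K$-algebra with the PBW basis $\mathcal{B}=\{a^{\alpha}=a_1^{\alpha_1}\cdots a_n^{\alpha_n}\mid \alpha=(\alpha_1,\ldots,\alpha_n)\in\mathbb{N}^n\}$. The following statements are equivalent. (i) There are a positive-degree function $d(\ )$ on $\mathcal{B}$ and a graded monomial ordering $\prec_{gr}$ on $\mathcal{B}$ with respect to $d(\ )$ such that $A$ is a solvable polynomial algebra with admissible system $(\mathcal{B},\prec_{gr})$, and such that for all $1\le i<j\le n$, in the relation $a_ja_i=\lambda_{ji}a_ia_j+f_{ji}$ (where $\lambda_{ji}\in K^*$, $f_{ji}=\sum_k\mu_ka^{\alpha(k)}$ with $\mu_k\in K$ and distinct $a^{\alpha(k)}\in\mathcal{B}$, and either $f_{ji}=0$ or $\mathbf{LM}(f_{ji})\prec_{gr}a_ia_j$) one has $d(a^{\alpha(k)})=d(a_ia_j)=d(a_j)+d(a_i)$ whenever $\mu_k\neq 0$. (ii) $A$ is an $\mathbb{N}$-graded solvable polynomial algebra of $(\mathcal{B},d(\ ))$-type, that is, $A$ is a solvable polynomial algebra with respect to $\mathcal{B}$ and some monomial ordering $\prec$ on $\mathcal{B}$, and $A$ is an $\mathbb{N}$-graded algebra of $(\mathcal{B},d(\ ))$-type for some positive-degree function $d(\ )$ on $\mathcal{B}$.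
   Context: Conventions: algebras are associative with $1$; $\mathbb{N}=\{0,1,2,\ldots\}$; $K^*=K\setminus\{0\}$. $A=K[a_1,\ldots,a_n]$ denotes a (not necessarily commutative) $K$-algebra generated by $a_1,\ldots,a_n$. That $\mathcal{B}$ is a PBW basis of $A$ means that the elements $a^{\alpha}$, $\alpha\in\mathbb{N}^n$, are pairwise distinct and form a $K$-basis of $A$. Leading monomial: given a total ordering $\prec$ on $\mathcal{B}$ and a nonzero $f=\sum_s\lambda_sa^{\alpha(s)}$ with $\lambda_s\in K^*$ and distinct $a^{\alpha(s)}\in\mathcal{B}$, $\mathbf{LM}(f)$ is the $\prec$-largest of the $a^{\alpha(s)}$; set $\mathbf{LM}(0)=0$. (Two-sided) monomial ordering on $\mathcal{B}$: a total well-ordering $\prec$ on $\mathcal{B}$ such that (1) for $a^{\alpha},a^{\beta},a^{\eta}\in\mathcal{B}$, if $\mathbf{LM}(a^{\alpha}a^{\beta}a^{\eta})\notin\{0,1\}$ and $a^{\beta}\ne\mathbf{LM}(a^{\alpha}a^{\beta}a^{\eta})$, then $a^{\beta}\prec\mathbf{LM}(a^{\alpha}a^{\beta}a^{\eta})$; (2) for $a^{\gamma},a^{\alpha},a^{\beta},a^{\eta}\in\mathcal{B}$, if $a^{\alpha}\prec a^{\beta}$, $\mathbf{LM}(a^{\gamma}a^{\alpha}a^{\eta})\neq 0$ and $\mathbf{LM}(a^{\gamma}a^{\beta}a^{\eta})\notin\{0,1\}$, then $\mathbf{LM}(a^{\gamma}a^{\alpha}a^{\eta})\prec\mathbf{LM}(a^{\gamma}a^{\beta}a^{\eta})$.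 Solvable polynomial algebra: $A$ with PBW basis $\mathcal{B}$ and a monomial ordering $\prec$ on $\mathcal{B}$ such that for all $a^{\alpha},a^{\beta}\in\mathcal{B}$, $a^{\alpha}a^{\beta}=\lambda_{\alpha,\beta}a^{\alpha+\beta}+f_{\alpha,\beta}$, where $\lambda_{\alpha,\beta}\in K^*$, $a^{\alpha+\beta}=a_1^{\alpha_1+\beta_1}\cdots a_n^{\alpha_n+\beta_n}$, $f_{\alpha,\beta}\in A$, and either $f_{\alpha,\beta}=0$ or $\mathbf{LM}(f_{\alpha,\beta})\prec a^{\alpha+\beta}$. Then $(\mathcal{B},\prec)$ is called an admissible system of $A$. Positive-degree function: a function $d(\ )$ on $\mathcal{B}$ given by an $n$-tuple $(m_1,\ldots,m_n)$ of positive integers via $d(a^{\alpha})=\sum_{i=1}^n\alpha_im_i$ (so $d(a_i)=m_i$); it is extended to nonzero $f=\sum_s\lambda_sa^{\alpha(s)}$ ($\lambda_s\in K^*$, distinct $a^{\alpha(s)}$) by $d(f)=\max_sd(a^{\alpha(s)})$. Graded monomial ordering: if $A$ is a solvable polynomial algebra with admissible system $(\mathcal{B},\prec)$, then $\prec$ is a graded monomial ordering with respect to the positive-degree function $d(\ )$ if for all $a^{\alpha},a^{\beta}\in\mathcal{B}$, $a^{\alpha}\prec a^{\beta}$ implies $d(a^{\alpha})\le d(a^{\beta})$. $\mathbb{N}$-graded algebra of $(\mathcal{B},d(\ ))$-type: for the positive-degree function $d(\ )$, setting $A_p=K\text{-span}\{a^{\alpha}\in\mathcal{B}\mid d(a^{\alpha})=p\}$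 for $p\in\mathbb{N}$, one has $A_pA_q\subseteq A_{p+q}$ for all $p,q\in\mathbb{N}$ (so that $A=\bigoplus_pA_p$ is an $\mathbb{N}$-graded algebra). *)

(* Defs.v *)
From mathcomp Require Import all_boot all_order all_algebra.
From mathcomp Require Import mpoly.

Set Implicit Arguments.
Unset Strict Implicit.
Unset Printing Implicit Defensive.

Import GRing.Theory.
Local Open Scope ring_scope.

(* The basis B = {a^alpha} is indexed by its exponents alpha : 'X_{1..n}.     *)
(* As the a^alpha are pairwise distinct (see PBW_basis), an ordering on B is  *)
(* given by a strict order lt on exponents: lt alpha beta stands for          *)
(* a^alpha < a^beta, and a leading monomial a^delta is given by delta.        *)

Section PBW.

Variables (K : fieldType) (A : algType K) (n : nat) (a : 'I_n -> A).

(* The product is taken in increasing order of i; A need not be commutative. *)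
Definition mon (alpha : 'X_{1..n}) : A := \prod_(i < n) a i ^+ alpha i.

(* {mpoly K[n]} only serves as the space of finitely supported families of    *)
(* coefficients indexed by 'X_{1..n}; its product plays no role.              *)
Definition lincomb (p : {mpoly K[n]}) : A :=
  \sum_(alpha <- msupp p) p@_alpha *: mon alpha.

Record PBW_basis : Prop := {
  mon_distinct : injective mon;
  mon_free : forall p, lincomb p = 0 -> p = 0;
  mon_span : forall f, exists p, f = lincomb p
}.

(* LM(f) = a^delta; for f = 0, where LM(0) = 0, there is no such delta.       *)
(* Hence LM(f) <> 0 is rendered by the existence of delta.                    *)
Definition is_LM (lt : rel 'X_{1..n}) (f : A) (delta : 'X_{1..n}) : Prop :=
  exists p, [/\ f = lincomb p, delta \in msupp p &
    forall alpha, alpha \in msupp p -> alpha != delta -> lt alpha delta].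

Record monomial_ordering (lt : rel 'X_{1..n}) : Prop := {
  mo_irr : irreflexive lt;
  mo_trans : transitive lt;
  mo_total : forall alpha beta, alpha != beta -> lt alpha beta || lt beta alpha;
  mo_wf : well_founded lt;
  mo_le_LM : forall alpha beta eta delta,
    is_LM lt (mon alpha * mon beta * mon eta) delta ->
    mon delta != 1 -> mon beta != mon delta -> lt beta delta;
  mo_LM_lt : forall gamma alpha beta eta delta delta',
    lt alpha beta ->
    is_LM lt (mon gamma * mon alpha * mon eta) delta ->
    is_LM lt (mon gamma * mon beta * mon eta) delta' ->
    mon delta' != 1 -> lt delta delta'
}.

Definition zero_or_LM_lt (lt : rel 'X_{1..n}) (f : A) (beta : 'X_{1..n}) :=
  f = 0 \/ exists2 delta, is_LM lt f delta & lt delta beta.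

Definition solvable_polynomial_algebra (lt : rel 'X_{1..n}) : Prop :=
  [/\ PBW_basis, monomial_ordering lt &
    forall alpha beta : 'X_{1..n}, exists (lambda : K) (f : A),
      [/\ lambda != 0,
          mon alpha * mon beta = lambda *: mon (alpha + beta)%MM + f &
          zero_or_LM_lt lt f (alpha + beta)%MM]].

(* A positive-degree function is given by its weights m i = d(a_i). *)
Definition positive_weights (m : 'I_n -> nat) : Prop := forall i, (0 < m i)%N.

Definition pdeg (m : 'I_n -> nat) (alpha : 'X_{1..n}) : nat :=
  (\sum_(i < n) alpha i * m i)%N.

Definition graded_ordering (m : 'I_n -> nat) (lt : rel 'X_{1..n}) : Prop :=
  forall alpha beta, lt alpha beta -> (pdeg m alpha <= pdeg m beta)%N.

(* f belongs to A_p. *)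
Definition homogeneous (m : 'I_n -> nat) (p : nat) (f : A) : Prop :=
  exists2 q, f = lincomb q & forall alpha, alpha \in msupp q -> pdeg m alpha = p.

(* A_p A_q is contained in A_(p+q); A is the direct sum of the A_p as soon as *)
(* B is a basis of A.                                                         *)
Definition graded_algebra (m : 'I_n -> nat) : Prop :=
  forall p q f g,
    homogeneous m p f -> homogeneous m q g -> homogeneous m (p + q) (f * g).

(* For i < j, a_i a_j is the element of B with exponent U_(i) + U_(j). *)
Definition homogeneous_relations (m : 'I_n -> nat) (lt : rel 'X_{1..n}) : Prop :=
  forall i j : 'I_n, (i < j)%N ->
    exists (lambda : K) (mu : {mpoly K[n]}),
      [/\ lambda != 0,
          a j * a i = lambda *: (a i * a j) + lincomb mu,
          zero_or_LM_lt lt (lincomb mu) (U_(i) + U_(j))%MM &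
          forall alpha, mu@_alpha != 0 ->
            pdeg m alpha = pdeg m (U_(i) + U_(j))%MM /\
            pdeg m (U_(i) + U_(j))%MM = (m j + m i)%N].

End PBW.

(* Main.v *)
Require Import Defs.
From mathcomp Require Import all_boot all_order all_algebra.
From mathcomp Require Import mpoly.

(** From (i) to (ii), the ordering is kept and only the inclusion of A_p A_q in
A_(p+q) is at stake; by bilinearity it suffices that the word obtained by
concatenating two basis monomials is homogeneous. Every word in the generators
is ([homogeneous_wprod]). An increasing word is a basis monomial. In any other
word, some factor a_j a_i with i < j is replaced by means of its relation. This
yields a multiple of the word with the two letters exchanged, which has the
same exponent and is less disordered, plus words of the same degree whose
exponent is smaller, because the monomial ordering is compatible with the
addition of exponents ([lt_add2l]). As the ordering is a well-ordering, the
rewriting terminates.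

From (ii) to (i), the given ordering is refined into [deg_lt], which compares
degrees first. In a graded algebra a product of basis monomials is homogeneous,
and on homogeneous elements both orderings select the same leading monomial
([is_LM_deg_lt]). In a solvable algebra the leading exponent of a product is
the sum of the exponents ([is_LM_mul]), so the conditions on a monomial
ordering reduce to compatibility of [deg_lt] with the addition of exponents,
which is clear because the degree is additive. The relations are homogeneous
since both a_j a_i and the basis
monomial a_i a_j are. *)

Set Implicit Arguments.
Unset Strict Implicit.
Unset Printing Implicit Defensive.

Import GRing.Theory.
Local Open Scope ring_scope.

(** * Elements supported on a set of exponents *)

Section SupportsAndWords.

Variables (K : fieldType) (A : algType K) (n : nat) (a : 'I_n -> A).

(** The evaluation morphism [mmap] is additive even when its target is not
commutative; the linearity of [lincomb] is inherited from it. *)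
Lemma lincombE p : lincomb a p = mmap (in_alg A) a p.
Proof. by apply: eq_bigr => alpha _; rewrite /= mulr_algl. Qed.

Lemma lincombD p q : lincomb a (p + q) = lincomb a p + lincomb a q.
Proof. by rewrite !lincombE mmapD. Qed.

Lemma lincombZ c p : lincomb a (c *: p) = c *: lincomb a p.
Proof. by rewrite !lincombE mmapZ /= mulr_algl. Qed.

Lemma lincombX alpha : lincomb a 'X_[alpha] = mon a alpha.
Proof. by rewrite /lincomb msuppX big_seq1 mcoeffX eqxx scale1r. Qed.

Lemma lincomb_inj : PBW_basis a -> injective (lincomb a).
Proof.
move=> hB p q eq_pq; apply/eqP; rewrite -subr_eq0; apply/eqP.
apply: (mon_free hB); rewrite -scaleN1r lincombD lincombZ eq_pq.
by rewrite scaleN1r subrr.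
Qed.

(** Both the homogeneous components and the sets of elements all of whose
monomials are smaller than a given one are instances. *)
Definition supported (P : 'X_{1..n} -> Prop) (f : A) : Prop :=
  exists2 q, f = lincomb a q & forall alpha, alpha \in msupp q -> P alpha.

Lemma supported0 P : supported P 0.
Proof. by exists 0 => [|alpha]; rewrite ?lincombE ?mmap0 // msupp0. Qed.

Lemma supportedD P f g : supported P f -> supported P g -> supported P (f + g).
Proof.
move=> [p -> Pp] [q -> Pq]; exists (p + q); first by rewrite lincombD.
by move=> alpha /msuppD_le; rewrite mem_cat => /orP[/Pp|/Pq].
Qed.

Lemma supportedZ P c f : supported P f -> supported P (c *: f).
Proof.
move=> [p -> Pp]; exists (c *: p); first by rewrite lincombZ.
by move=> alpha /msuppZ_le /Pp.
Qed.

Lemma supported_mon (P : 'X_{1..n} -> Prop) alpha :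
  P alpha -> supported P (mon a alpha).
Proof.
move=> Palpha; exists 'X_[alpha]; first by rewrite lincombX.
by move=> beta; rewrite msuppX inE => /eqP ->.
Qed.

Lemma sub_supported (P Q : 'X_{1..n} -> Prop) f :
  (forall alpha, P alpha -> Q alpha) -> supported P f -> supported Q f.
Proof. by move=> PQ [p -> Pp]; exists p => // alpha /Pp /PQ. Qed.

Lemma supported_lincomb P p : PBW_basis a ->
  supported P (lincomb a p) -> forall alpha, alpha \in msupp p -> P alpha.
Proof. by move=> hB [q /(lincomb_inj hB) ->]. Qed.

(** Bilinearity: membership of a product can be tested on basis monomials. The
two-sided form covers left and right factors and contexts inside words. *)
Lemma supported_mul P Q g h f :
    (forall alpha, P alpha -> supported Q (g * mon a alpha * h)) ->
  supported P f -> supported Q (g * f * h).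
Proof.
move=> PQ [p -> Pp]; rewrite /lincomb mulr_sumr mulr_suml big_seq.
elim/big_ind: _ => [|x y|alpha /Pp /PQ]; first exact: supported0.
  exact: supportedD.
by rewrite -scalerAr -scalerAl; apply: supportedZ.
Qed.

(** * Words in the generators *)

Definition wprod (w : seq 'I_n) : A := \prod_(i <- w) a i.

Definition expo (w : seq 'I_n) : 'X_{1..n} := [multinom count_mem i w | i < n].

Definition mword (alpha : 'X_{1..n}) : seq 'I_n :=
  flatten [seq nseq (alpha i) i | i <- enum 'I_n].

Lemma wprod_cat u v : wprod (u ++ v) = wprod u * wprod v.
Proof. exact: big_cat. Qed.

Lemma expo_cat u v : expo (u ++ v) = (expo u + expo v)%MM.
Proof. by apply/mnmP=> i; rewrite mnmDE !mnmE count_cat. Qed.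

Lemma expo1 i : expo [:: i] = U_(i)%MM.
Proof. by apply/mnmP=> j; rewrite mnmE mnm1E /= addn0. Qed.

Lemma expo_mword alpha : expo (mword alpha) = alpha.
Proof.
apply/mnmP=> i; rewrite mnmE count_flatten -map_comp sumnE big_map enumT.
rewrite -[Finite.enum _]/(index_enum _) (bigD1 i) //= count_nseq /= eqxx.
rewrite mul1n big1 ?addn0 // => j.
by move=> /negPf ji; rewrite count_nseq /= ji.
Qed.

Lemma wprod_mword alpha : wprod (mword alpha) = mon a alpha.
Proof.
rewrite /wprod big_flatten big_map enumT /mon [index_enum _]unlock.
apply: eq_bigr => i _.
by rewrite big_nseq -[iter _ _ _]/(iter _ ( *%R (a i)) 1) iter_mulr_1.
Qed.

Definition increasing : seq 'I_n -> bool := sorted (fun i j : 'I_n => i <= j)%N.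

(** Together with the next lemma, this identifies the basis monomials with the
increasing words. *)
Lemma increasing_mword alpha : increasing (mword alpha).
Proof.
have le_tr : transitive (fun i j : 'I_n => i <= j)%N.
  by move=> j i k; apply: leq_trans.
rewrite /increasing sorted_pairwise // /mword.
have: pairwise (fun i j : 'I_n => i <= j)%N (enum 'I_n).
  rewrite -sorted_pairwise //; have := iota_sorted 0 n.
  by rewrite -val_enum_ord sorted_map.
elim: (enum 'I_n) => //= i s IHs /andP[/allP le_is /IHs {}IHs].
rewrite pairwise_cat IHs andbT; apply/andP; split.
  apply/allrelP=> j k; rewrite mem_nseq => /andP[_ /eqP ->].
  by case/flatten_mapP=> l /le_is le_il; rewrite mem_nseq => /andP[_ /eqP ->].
by elim: (alpha i) => //= k ->; rewrite andbT; apply/allP=> j /nseqP[-> _] /=.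
Qed.

Lemma wprod_increasing w : increasing w -> wprod w = mon a (expo w).
Proof.
move=> w_incr; rewrite -wprod_mword; congr (wprod _).
apply: (sorted_eq _ _ w_incr (increasing_mword _)).
- by move=> j i k; apply: leq_trans.
- by move=> i j; rewrite -eqn_leq => /eqP/val_inj.
apply/allP=> i _ /=; apply/eqP.
by have /mnmP/(_ i) := expo_mword (expo w); rewrite ![expo _ i]mnmE.
Qed.

Lemma mon0 : mon a 0%MM = 1.
Proof. by rewrite /mon big1 // => i _; rewrite mnm0E. Qed.

Lemma monU i : mon a U_(i)%MM = a i.
Proof. by rewrite -expo1 -wprod_increasing // /wprod big_seq1. Qed.

Lemma monUU (i j : 'I_n) : (i <= j)%N -> mon a (U_(i) + U_(j))%MM = a i * a j.
Proof.
move=> le_ij; rewrite -!expo1 -expo_cat -wprod_increasing /increasing /= ?le_ij //.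
by rewrite /wprod big_cons big_seq1.
Qed.

(** The two adjacent letters are the place where a relation a_j a_i applies. *)
Lemma not_increasing w : ~~ increasing w ->
  exists u (i j : 'I_n) v, (i < j)%N /\ w = u ++ j :: i :: v.
Proof.
elim: w => // j [|i v] // IHw; rewrite /increasing /= negb_and.
case: leqP => [_ /IHw [u [i' [j' [v' [lt_ij ->]]]]]|lt_ij _].
  by exists (j :: u), i', j', v'.
by exists [::], i, j, v.
Qed.

(** Each letter is weighted by the number of letters to its right, so that moving
a larger letter to the right decreases the total. *)
Fixpoint disorder (w : seq 'I_n) : nat :=
  if w is i :: v then (size v * i + disorder v)%N else 0%N.

Lemma disorder_swap u (i j : 'I_n) v : (i < j)%N ->
  (disorder (u ++ i :: j :: v) < disorder (u ++ j :: i :: v))%N.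
Proof.
move=> lt_ij; elim: u => [|k u IHu] /=; last by rewrite !size_cat ltn_add2l.
by rewrite !addnA ltn_add2r !mulSn addnAC ltn_add2r ltn_add2r.
Qed.

End SupportsAndWords.

(** * The degree of exponents *)

Lemma pdegD n (m : 'I_n -> nat) alpha beta :
  pdeg m (alpha + beta)%MM = (pdeg m alpha + pdeg m beta)%N.
Proof.
by rewrite /pdeg -big_split; apply: eq_bigr => i _; rewrite mnmDE mulnDl.
Qed.

Lemma pdegU n (m : 'I_n -> nat) i : pdeg m U_(i)%MM = m i.
Proof.
rewrite /pdeg (bigD1 i) //= mnm1E eqxx mul1n big1 ?addn0 // => j.
by rewrite eq_sym mnm1E => /negPf ->.
Qed.

(** * Leading monomials in a solvable polynomial algebra *)

Section LeadingMonomials.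

Variables (K : fieldType) (A : algType K) (n : nat) (a : 'I_n -> A).
Hypothesis hB : PBW_basis a.
Implicit Types (lt : rel 'X_{1..n}) (f g : A) (alpha beta delta : 'X_{1..n}).

Lemma is_LM_lead lt c r delta : irreflexive lt -> c != 0 ->
  supported a (fun alpha => lt alpha delta) r ->
  is_LM a lt (c *: mon a delta + r) delta.
Proof.
move=> lt_irr c_neq0 [q -> lt_q]; exists (c *: 'X_[delta] + q).
have q_delta : q@_delta = 0.
  by apply: memN_msupp_eq0; apply/negP => /lt_q; rewrite lt_irr.
split; first by rewrite lincombD lincombZ lincombX.
  by rewrite mcoeff_msupp mcoeffD mcoeffZ mcoeffX eqxx mulr1 q_delta addr0.
move=> alpha /msuppD_le; rewrite mem_cat => /orP[/msuppZ_le|/lt_q //].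
by rewrite msuppX inE => ->.
Qed.

Lemma is_LM_unique lt f delta delta' : irreflexive lt -> transitive lt ->
  is_LM a lt f delta -> is_LM a lt f delta' -> delta = delta'.
Proof.
move=> lt_irr lt_tr [p [-> p_delta lt_p]] [q [/(lincomb_inj hB) <- q_delta lt_q]].
apply/eqP/negP => /negP ne; have := lt_q _ p_delta ne.
rewrite eq_sym in ne; have := lt_p _ q_delta ne => lt1 lt2.
by have := lt_tr _ _ _ lt1 lt2; rewrite lt_irr.
Qed.

Lemma supported_zero_or_LM_lt lt f beta : transitive lt ->
  zero_or_LM_lt a lt f beta -> supported a (fun alpha => lt alpha beta) f.
Proof.
move=> lt_tr [->|[delta [p [-> p_delta lt_p]] lt_delta]]; first exact: supported0.
exists p => // alpha /lt_p; have [-> //|_ /(_ isT)] := eqVneq alpha delta.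
by move=> /lt_tr; apply.
Qed.

Section Solvable.

Variable lt : rel 'X_{1..n}.
Hypothesis hlt : solvable_polynomial_algebra a lt.

Let lt_mo : monomial_ordering a lt. Proof. by case: hlt. Qed.
Let lt_irr := mo_irr lt_mo.
Let lt_tr := mo_trans lt_mo.

Lemma mon_mul alpha beta : exists (c : K) (r : A),
  [/\ c != 0, mon a alpha * mon a beta = c *: mon a (alpha + beta)%MM + r &
      supported a (fun delta => lt delta (alpha + beta)%MM) r].
Proof.
have [_ _ /(_ alpha beta) [c [r [c_neq0 -> lt_r]]]] := hlt.
by exists c, r; split=> //; apply: supported_zero_or_LM_lt.
Qed.

(** Apply the first axiom of monomial orderings to 1 * 1 * a^alpha, whose leading
monomial is a^alpha. *)
Lemma lt0_mon alpha : alpha != 0%MM -> lt 0%MM alpha.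
Proof.
move=> alpha_neq0; have mon_neq1 : mon a alpha != 1.
  by rewrite -(mon0 a) (inj_eq (mon_distinct hB)).
apply: (mo_le_LM lt_mo (alpha := 0%MM) (eta := alpha)) => //.
  rewrite mon0 !mul1r -[mon a alpha]scale1r -[_ *: _]addr0.
  by apply: is_LM_lead => //; [apply: oner_neq0 | apply: supported0].
by rewrite mon0 eq_sym.
Qed.

(** The leading exponent of a^gamma a^eta is gamma + eta, so this is the second
axiom of monomial orderings; its exception, gamma + beta = 0, would make beta
the least exponent. *)
Lemma lt_add2l gamma alpha beta :
  lt alpha beta -> lt (gamma + alpha)%MM (gamma + beta)%MM.
Proof.
move=> lt_ab; have LM_mul eta : is_LM a lt (mon a gamma * mon a eta * mon a 0%MM)
                                      (gamma + eta)%MM.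
  have [c [r [c_neq0 -> lt_r]]] := mon_mul gamma eta.
  by rewrite mon0 mulr1; apply: is_LM_lead.
apply: (mo_LM_lt lt_mo lt_ab (LM_mul _) (LM_mul _)).
rewrite -(mon0 a) (inj_eq (mon_distinct hB)) mnmD_eq0 negb_and orbC.
apply/orP; left; apply/eqP => beta0; move: lt_ab; rewrite beta0.
have [->|/lt0_mon lt0a lta0] := eqVneq alpha 0%MM; first by rewrite lt_irr.
by have := lt_tr lt0a lta0; rewrite lt_irr.
Qed.

Lemma lt_add2r gamma alpha beta :
  lt alpha beta -> lt (alpha + gamma)%MM (beta + gamma)%MM.
Proof. by rewrite ![(_ + gamma)%MM]addmC; apply: lt_add2l. Qed.

(** The lower terms of a^gamma a^alpha stay lower once multiplied by a^eta, by
compatibility with addition. *)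
Lemma is_LM_mul gamma alpha eta :
  is_LM a lt (mon a gamma * mon a alpha * mon a eta) (gamma + alpha + eta)%MM.
Proof.
have [c [r [c_neq0 -> lt_r]]] := mon_mul gamma alpha.
have [c' [r' [c'_neq0 eq_mon lt_r']]] := mon_mul (gamma + alpha)%MM eta.
rewrite mulrDl -scalerAl eq_mon scalerDr scalerA -addrA.
apply: is_LM_lead => //; first by rewrite mulf_neq0.
apply: supportedD; first exact: supportedZ.
rewrite -[r]mul1r; apply: supported_mul lt_r => delta lt_delta; rewrite mul1r.
have [d [s [_ -> lt_s]]] := mon_mul delta eta.
have lt_sum := lt_add2r eta lt_delta; apply: supportedD.
  by apply: supportedZ; apply: supported_mon.
by apply: sub_supported lt_s => alpha' /lt_tr; apply.
Qed.

End Solvable.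

(** * Homogeneous relations make the algebra graded *)

Section Graded.

Variables (m : 'I_n -> nat) (lt : rel 'X_{1..n}).
Hypotheses (hlt : solvable_polynomial_algebra a lt)
           (hrel : homogeneous_relations a m lt).

Let lt_mo : monomial_ordering a lt. Proof. by case: hlt. Qed.

Lemma exchange_relation (i j : 'I_n) : (i < j)%N ->
  exists (c : K) (r : A), a j * a i = c *: (a i * a j) + r /\
    supported a (fun alpha => lt alpha (U_(i) + U_(j))%MM /\
                         pdeg m alpha = pdeg m (U_(i) + U_(j))%MM) r.
Proof.
move=> /hrel [c [mu [_ eq_ji lt_mu deg_mu]]]; exists c, (lincomb a mu).
split=> //; exists mu => // alpha mu_alpha; split.
  have lt_supp := supported_zero_or_LM_lt (mo_trans lt_mo) lt_mu.
  exact: (supported_lincomb hB lt_supp).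
by have [] := deg_mu alpha; rewrite -?mcoeff_msupp.
Qed.

(** Lexicographic induction on the exponent, for the monomial ordering, and on the
disorder. *)
Lemma homogeneous_wprod w : homogeneous a m (pdeg m (expo w)) (wprod a w).
Proof.
have [s] := ubnP (disorder w); move eq_sigma: (expo w) => sigma.
elim/(well_founded_ind (mo_wf lt_mo)): sigma s w eq_sigma => sigma IHsigma.
elim=> // s IHs w eq_sigma; have [|w_inv] := boolP (increasing w).
  by move=> /wprod_increasing -> _; apply: supported_mon; rewrite eq_sigma.
have [u [i [j [v [lt_ij eq_w]]]]] := not_increasing w_inv.
rewrite {w w_inv}eq_w in eq_sigma * => le_s.
have [c [r [eq_ji r_supp]]] := exchange_relation lt_ij.
have eq_swap : expo (u ++ i :: j :: v) = sigma.
  rewrite -eq_sigma; apply/mnmP=> k; rewrite !mnmE !count_cat /=.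
  by congr addn; rewrite addnCA.
have -> : wprod a (u ++ j :: i :: v)
          = c *: wprod a (u ++ i :: j :: v) + wprod a u * r * wprod a v.
  rewrite !wprod_cat /wprod !big_cons [a j * _]mulrA eq_ji mulrDl mulrDr.
  by rewrite -scalerAl -scalerAr !mulrA.
apply: supportedD.
  apply/supportedZ/IHs => //; rewrite ltnS in le_s.
  exact: leq_trans (disorder_swap _ _ lt_ij) le_s.
apply: supported_mul r_supp => alpha [lt_alpha deg_alpha].
(* A monomial of the remainder of the relation is itself a word, so in its
   context it gives a word, with a smaller exponent of the same degree. *)
rewrite -wprod_mword -!wprod_cat.
have eq_sum : sigma = (expo u + (U_(i) + U_(j)) + expo v)%MM.
  rewrite -eq_swap -[i :: j :: v]/([:: i] ++ [:: j] ++ v) !expo_cat !expo1.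
  by rewrite !addmA.
have -> : pdeg m sigma = pdeg m (expo ((u ++ mword alpha) ++ v)).
  by rewrite eq_sum !expo_cat expo_mword !pdegD deg_alpha pdegD.
apply: (IHsigma _ _ _ _ erefl (ltnSn _)).
rewrite eq_sum !expo_cat expo_mword; apply: lt_add2r => //.
exact: lt_add2l.
Qed.

Lemma graded_of_relations : graded_algebra a m.
Proof.
move=> p q f g f_p g_q; rewrite -[f * g]mulr1.
apply: supported_mul g_q => beta deg_beta; rewrite mulr1 -[f]mul1r.
apply: supported_mul f_p => alpha deg_alpha; rewrite mul1r.
rewrite -!wprod_mword -wprod_cat -deg_alpha -deg_beta -pdegD.
rewrite -{1}[alpha]expo_mword -{1}[beta]expo_mword -expo_cat.
exact: homogeneous_wprod.
Qed.

End Graded.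

(** * Refining a monomial ordering by the degree *)

Section DegreeRefinement.

Variables (m : 'I_n -> nat) (lt : rel 'X_{1..n}).

Definition deg_lt : rel 'X_{1..n} := fun alpha beta =>
  (pdeg m alpha < pdeg m beta)%N || (pdeg m alpha == pdeg m beta) && lt alpha beta.

Lemma graded_deg_lt : graded_ordering m deg_lt.
Proof. by move=> alpha beta /orP[/ltnW|/andP[/eqP ->]]. Qed.

Lemma deg_lt_wf : well_founded lt -> well_founded deg_lt.
Proof.
move=> lt_wf alpha; have [d] := ubnP (pdeg m alpha).
elim: d alpha => [alpha|d IHd alpha]; first by rewrite ltn0; case/notF.
rewrite ltnS.
elim/(well_founded_ind lt_wf): alpha => alpha IHalpha le_d.
constructor=> beta /orP[lt_deg|/andP[/eqP eq_deg lt_ba]].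
  by apply: IHd; apply: leq_trans lt_deg le_d.
by apply: IHalpha; rewrite ?eq_deg.
Qed.

(** All monomials of a homogeneous element have the same degree, so [deg_lt] and
[lt] compare them alike. *)
Lemma is_LM_deg_lt d f delta : homogeneous a m d f ->
  is_LM a deg_lt f delta <-> is_LM a lt f delta /\ pdeg m delta = d.
Proof.
move=> [q -> deg_q]; split=> [|[]] [p [/(lincomb_inj hB) <- q_delta lt_q]].
  split; last exact: deg_q.
  exists q; split=> // alpha q_alpha /(lt_q _ q_alpha).
  by rewrite /deg_lt !deg_q // ltnn eqxx.
move=> _; exists q; split=> // alpha q_alpha /(lt_q _ q_alpha).
by rewrite /deg_lt !deg_q // ltnn eqxx.
Qed.

Hypotheses (hlt : solvable_polynomial_algebra a lt) (hm : graded_algebra a m).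

Let lt_mo : monomial_ordering a lt. Proof. by case: hlt. Qed.
Let lt_irr := mo_irr lt_mo.
Let lt_tr := mo_trans lt_mo.

Lemma homogeneous_mon alpha : homogeneous a m (pdeg m alpha) (mon a alpha).
Proof. exact: supported_mon. Qed.

(** The product is homogeneous, hence its leading monomial for [deg_lt] is the one
for [lt]. *)
Lemma is_LM_deg_lt_mul gamma alpha eta delta :
  is_LM a deg_lt (mon a gamma * mon a alpha * mon a eta) delta ->
  delta = (gamma + alpha + eta)%MM.
Proof.
have hom_mul := hm (hm (homogeneous_mon gamma) (homogeneous_mon alpha))
                   (homogeneous_mon eta).
move=> /(is_LM_deg_lt _ hom_mul) [LM_delta _].
exact: is_LM_unique LM_delta (is_LM_mul hlt _ _ _).
Qed.

Lemma deg_lt_add gamma alpha beta eta : deg_lt alpha beta ->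
  deg_lt (gamma + alpha + eta)%MM (gamma + beta + eta)%MM.
Proof.
rewrite /deg_lt !pdegD ltn_add2r ltn_add2l eqn_add2r eqn_add2l.
case/orP=> [-> //|/andP[-> lt_ab]]; apply/orP; right.
by apply: lt_add2r => //; apply: lt_add2l.
Qed.

Lemma deg_lt0 alpha : alpha != 0%MM -> deg_lt 0%MM alpha.
Proof.
move=> /(lt0_mon hlt) lt0a; rewrite /deg_lt lt0a andbT orbC -leq_eqVlt.
by rewrite /pdeg big1 // => i _; rewrite mnm0E.
Qed.

Lemma monomial_ordering_deg_lt : monomial_ordering a deg_lt.
Proof.
split.
- by move=> alpha; rewrite /deg_lt ltnn eqxx lt_irr.
- move=> beta alpha gamma /orP[lt_ab|/andP[/eqP eq_ab lt_ab]].
    by move=> /graded_deg_lt le_bc; rewrite /deg_lt (leq_trans lt_ab le_bc).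
  by rewrite /deg_lt eq_ab => /orP[->|/andP[-> /(lt_tr lt_ab) ->]] //; rewrite orbT.
- move=> alpha beta ne_ab; rewrite /deg_lt.
  by case: ltngtP => //= _; apply: (mo_total lt_mo).
- exact: deg_lt_wf (mo_wf lt_mo).
- move=> alpha beta eta delta /is_LM_deg_lt_mul -> _ ne_beta.
  rewrite [(alpha + beta)%MM]addmC -addmA; set gamma := (alpha + eta)%MM.
  have gamma_neq0 : gamma != 0%MM.
    apply: contra_neq ne_beta => gamma0.
    by rewrite [(alpha + beta)%MM]addmC -addmA -/gamma gamma0 addm0.
  by have := deg_lt_add beta 0%MM (deg_lt0 gamma_neq0); rewrite !addm0.
move=> gamma alpha beta eta delta delta' lt_ab.
move=> /is_LM_deg_lt_mul -> /is_LM_deg_lt_mul -> _.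
exact: deg_lt_add.
Qed.

Lemma solvable_deg_lt : solvable_polynomial_algebra a deg_lt.
Proof.
split; [exact: hB | exact: monomial_ordering_deg_lt | move=> alpha beta].
have [_ _ /(_ alpha beta) [c [r [c_neq0 eq_mul lt_r]]]] := hlt.
exists c, r; split=> //; case: lt_r => [->|[delta LM_r lt_delta]]; first by left.
have hom_r : homogeneous a m (pdeg m (alpha + beta)%MM) r.
  have -> : r = mon a alpha * mon a beta + - c *: mon a (alpha + beta)%MM.
    by rewrite eq_mul scaleNr addrAC subrr add0r.
  apply: supportedD; last exact/supportedZ/homogeneous_mon.
  by rewrite pdegD; apply: hm; apply: homogeneous_mon.
have deg_delta : pdeg m delta = pdeg m (alpha + beta)%MM.
  have [q eq_r deg_q] := hom_r; have [p [eq_r' p_delta _]] := LM_r.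
  by apply: deg_q; rewrite -(lincomb_inj hB (etrans (esym eq_r') eq_r)).
right; exists delta; first by apply/(is_LM_deg_lt _ hom_r).
by rewrite /deg_lt deg_delta ltnn eqxx.
Qed.

End DegreeRefinement.

Lemma homogeneous_relations_of_graded m lt :
    solvable_polynomial_algebra a lt -> graded_algebra a m ->
  homogeneous_relations a m lt.
Proof.
move=> [_ _ mul_mon] hm i j lt_ij.
have [c [r [c_neq0 eq_mul lt_r]]] := mul_mon U_(j)%MM U_(i)%MM.
have deg_ij : pdeg m (U_(i) + U_(j))%MM = (m j + m i)%N.
  by rewrite pdegD !pdegU addnC.
rewrite [(U_(j) + _)%MM]addmC in eq_mul lt_r.
have hom_r : homogeneous a m (m j + m i) r.
  have -> : r = mon a U_(j)%MM * mon a U_(i)%MM + - c *: mon a (U_(i) + U_(j))%MM.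
    by rewrite eq_mul scaleNr addrAC subrr add0r.
  apply: supportedD; last by apply/supportedZ/supported_mon.
  by rewrite -[m j]pdegU -[m i]pdegU; apply: hm; apply: homogeneous_mon.
have [mu eq_r deg_mu] := hom_r.
exists c, mu; rewrite -eq_r -(monUU _ (ltnW lt_ij)) deg_ij.
split=> //; first by rewrite -!(monU a) eq_mul.
by move=> alpha; rewrite -mcoeff_msupp => /deg_mu.
Qed.

End LeadingMonomials.

Theorem proposition3p2 (K : fieldType) (A : algType K) (n : nat)
    (a : 'I_n -> A) (hB : PBW_basis a) :
  (exists (m : 'I_n -> nat) (lt : rel 'X_{1..n}),
      [/\ positive_weights m,
          graded_ordering m lt,
          solvable_polynomial_algebra a lt &
          homogeneous_relations a m lt])
  <->
  ((exists lt : rel 'X_{1..n}, solvable_polynomial_algebra a lt) /\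
   (exists m : 'I_n -> nat, positive_weights m /\ graded_algebra a m)).
Proof.
split=> [[m [lt [m_gt0 _ hlt hrel]]]|[[lt hlt] [m [m_gt0 hm]]]].
  split; first by exists lt.
  by exists m; split=> //; apply: graded_of_relations hrel.
have hdeg := solvable_deg_lt hB hlt hm.
exists m, (deg_lt m lt); split=> //; first exact: graded_deg_lt.
exact: homogeneous_relations_of_graded.
Qed.
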